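(* Let $\psi:(0,\infty)\to(0,\infty)$ be a smooth convex decreasing function satisfying $\lim_{x\to+\infty}\psi(x)=\inf\psi=0$. The following assertions are equivalent: (i) (Łojasiewicz inequality at infinity) There exists $c>0$ such that $$\liminf_{x\to+\infty}\frac{x\,|\psi'(x)|}{\psi(x)}\ \ge\ c>0.$$ (ii) There exist $m,n>1$ and $R>0$ such that $$\frac{\psi(x)}{m}\ \ge\ \psi(nx)\qquad\text{for all }x\in(R,+\infty).$$ (iii) For every $m>1$ there exist $n>1$ and $R>0$ such that $$\frac{\psi(x)}{m}\ \ge\ \psi(nx)\qquad\text{for all }x\in(R,+\infty).$$ *)

(* Defs.v *)
From HB Require Import structures.
From mathcomp Require Import all_boot all_order all_algebra.
From mathcomp Require Import all_classical all_reals all_analysis.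

Set Implicit Arguments.
Unset Strict Implicit.
Unset Printing Implicit Defensive.

Import Order.TTheory GRing.Theory Num.Theory.
Import numFieldNormedType.Exports.

Local Open Scope classical_set_scope.
Local Open Scope ring_scope.

(* C^oo on an open set A; [f] is a total function whose values outside of A
   are irrelevant, since derivatives are local. *)
Definition smooth_on (R : realType) (A : set R) (f : R -> R) : Prop :=
  forall (k : nat) (x : R), A x -> derivable (derive1n k f) x 1.

(* Main.v *)
Require Import Defs.
From HB Require Import structures.
From mathcomp Require Import all_boot all_order all_algebra.
From mathcomp Require Import all_classical all_reals all_analysis.
From mathcomp Require Import lra.
Import Order.TTheory GRing.Theory Num.Theory.
Import numFieldNormedType.Exports.
Local Open Scope classical_set_scope.
Local Open Scope ring_scope.

(** The tangent inequality [psi x + psi' x * (y - x) <= psi y] drives both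
    directions. Anchored at [2 x] and evaluated at [x], it turns the lower bound
    on [x |psi'| / psi] into [psi (2 x) <= psi x / (1 + c / 4)]; anchored at [x]
    and evaluated at [n x], it gives
    [psi x (1 - 1 / m) <= psi x - psi (n x) <= (n - 1) x |psi' x|]. A single
    decay factor [m > 1] yields all of them by iteration, replacing [n] by
    a power of [n]. *)

(** The limit inferior is a supremum of infima over members of [F], and the set where [c <= f] is
    itself such a member. *)
Lemma le_limf_einf (T : choiceType) (X : filteredType T) (R : realType)
    (f : X -> \bar R) (F : set_system X) (c : \bar R) :
  (\forall x \near F, (c <= f x)%E) -> (c <= limf_einf f F)%E.
Proof.
move=> Fc; rewrite limf_einfE.
apply: (@le_trans _ _ (ereal_inf [set f x | x in [set x | (c <= f x)%E]])).
  by apply: le_ereal_inf_tmp => _ [x /= cfx <-].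
by apply: ereal_sup_ubound; exists [set x | (c <= f x)%E].
Qed.

Lemma lt_limf_einf (T : choiceType) (X : filteredType T) (R : realType)
    (f : X -> \bar R) (F : set_system X) {FF : Filter F} (c : \bar R) :
  (c < limf_einf f F)%E -> \forall x \near F, (c < f x)%E.
Proof.
rewrite limf_einfE => /ereal_sup_gt[_ [V FV <-] cV].
apply: filterS FV => x Vx; apply: lt_le_trans cV _.
by apply: ereal_inf_lbound; exists x.
Qed.

(** The left-hand increment is the derivative of [f] at [x] along [y - x]. Taken as a limit from the
    right, its quotients at [0 < t <= 1] are at most [f y - f x], by convexity with weight [t] on
    [y]. *)
Lemma convex_function_above_tangent (R : realType) (D : set R) (f : R -> R)
    (x y : R) :
  convex_function (E := R^o) D f -> D x -> D y -> derivable f x 1 ->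
  f x + derive1 f x * (y - x) <= f y.
Proof.
move=> cvxf Dx Dy dfx; rewrite -lerBrDl.
have dff : differentiable f x by apply/derivable1_diffP.
have dfv : derivable f x (y - x) by exact: diff_derivable.
have -> : derive1 f x * (y - x) = 'D_(y - x) f x.
  by rewrite deriveE // deriv1E //= mulrC.
have /cvg_dnbhs_at_right quot_cvg := dfv.
rewrite /derive -(cvg_lim _ quot_cvg) //.
apply: limr_le; first by apply/cvg_ex; eexists; exact: quot_cvg.
near=> t.
have t0 : 0 < t by [].
have t1 : t <= 1 by near: t; exact: nbhs_right_le.
have := cvxf (Itv01 (ltW t0) t1) y x (mem_set Dy) (mem_set Dx).
rewrite !convRE /= /unstable.onem => cvxt.
rewrite /GRing.scale /= ler_pdivrMl //.
have -> : t * (y - x) + x = t * y + (1 - t) * x by lra.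
lra.
Unshelve. all: by end_near. Qed.

(** The geometric sequence [b * a^-1 ^+ k] tends to 0, hence drops below 1. *)
Lemma expr_unbounded (R : realType) (a b : R) :
  1 < a -> exists k : nat, b <= a ^+ k.
Proof.
move=> a1; have a0 : 0 < a by lra.
have /cvgr_lt/(_ _ ltr01) : (fun k => b * a^-1 ^+ k) @ \oo --> (0 : R).
  by apply: cvg_geometric; rewrite ger0_norm ?invr_ge0 ?invf_lt1 // ltW.
case=> k _ /(_ k (leqnn k)) /=.
rewrite exprVn ltr_pdivrMr ?exprn_gt0 // mul1r => /ltW bak.
by exists k.
Qed.

(** Since [1 <= n] and [0 <= r], the point [n ^+ k * x] stays beyond [r], so the decay applies again
    there. *)
Lemma iter_decay (R : realType) (f : R -> R) (m n r : R) :
  0 < m -> 1 <= n -> 0 <= r ->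
  (forall x, r < x -> f (n * x) <= f x / m) ->
  forall k x, r < x -> f (n ^+ k * x) <= f x / m ^+ k.
Proof.
move=> m0 n1 r0 decay; elim=> [|k IH] x rx; first by rewrite !expr0 mul1r divr1.
have rnx : r < n ^+ k * x.
  by apply: (lt_le_trans rx); rewrite ler_peMl ?exprn_ege1 //; lra.
rewrite exprS -mulrA; apply: le_trans (decay _ rnx) _.
by rewrite exprSr invfM mulrA ler_pM2r ?invr_gt0 // IH.
Qed.

Theorem theorem3p1 (R : realType) (psi : R -> R)
    (psi_gt0 : forall x : R, 0 < x -> 0 < psi x)
    (psi_smooth : smooth_on `]0, +oo[ psi)
    (psi_convex : convex_function (E := R^o) `]0, +oo[ psi)
    (psi_decr : forall x y : R, 0 < x -> x <= y -> psi y <= psi x)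
    (psi_lim : psi x @[x --> +oo] --> (0 : R))
    (psi_inf : inf (psi @` `]0, +oo[) = 0) :
  let loja_at_infinity :=
    exists c : R, 0 < c /\
      (c%:E <= limf_einf (fun x : R => (x * `|derive1 psi x| / psi x)%:E)
                         (pinfty_nbhs R))%E in
  let decay_some :=
    exists m n r : R, [/\ 1 < m, 1 < n, 0 < r &
      forall x : R, r < x -> psi (n * x) <= psi x / m] in
  let decay_all :=
    forall m : R, 1 < m -> exists n r : R, [/\ 1 < n, 0 < r &
      forall x : R, r < x -> psi (n * x) <= psi x / m] in
  (loja_at_infinity <-> decay_some) /\ (decay_some <-> decay_all).
Proof.
move=> loja_at_infinity decay_some decay_all.
have tangent (x y : R) : 0 < x -> 0 < y ->
    psi x + derive1 psi x * (y - x) <= psi y.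
  move=> x0 y0; apply: (convex_function_above_tangent _ _ _ _ _ psi_convex);
    rewrite /= ?in_itv /= ?x0 ?y0 //.
  by apply: (psi_smooth 0%N); rewrite /= in_itv /= x0.
have dpsi_le0 (x : R) : 0 < x -> derive1 psi x <= 0.
  move=> x0; have x2 : 0 < x + x by lra.
  (* The tangent at [x] read at [x + x] gives [psi x + psi' x * x <= psi (x + x) <= psi x]. *)
  have := tangent x (x + x) x0 x2; have := psi_decr x (x + x) x0 ltac:(lra).
  by rewrite addrK -(pmulr_lle0 _ x0); lra.
split; split.
- move=> [c [c0 c_le]].
  (* Halving [c] provides the strict inequality that yields an eventual bound. *)
  have c2_lt : ((c / 2)%:E < c%:E)%E by rewrite lte_fin; lra.
  have /lt_limf_einf[A [_ Ac]] := lt_le_trans c2_lt c_le.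
  (* At [2 * x] the bound says that [x * |psi' (2 * x)|] exceeds [c / 4 * psi (2 * x)]. The
     threshold is positive and ensures [A < 2 * x]. *)
  exists (1 + c / 4), 2, (`|A| + 1); split; [lra|lra|exact: ltr_wpDl|].
  move=> x xA; have A0 := normr_ge0 A; have leA := ler_norm A.
  have x0 : 0 < x by lra.
  have y0 : 0 < 2 * x by lra.
  have /Ac : A < 2 * x by lra.
  rewrite lte_fin ltr_pdivlMr ?psi_gt0 // ler0_norm ?dpsi_le0 // => loja.
  have m0 : 0 < 1 + c / 4 by lra.
  rewrite ler_pdivlMr //; have := tangent (2 * x) x y0 x0; lra.
- move=> [m [n [r [m1 n1 r0 decay]]]].
  have n0 : 0 < n - 1 by lra.
  have m0 : 0 < m by lra.
  exists ((1 - m^-1) / (n - 1)); split.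
    by rewrite divr_gt0 // subr_gt0 invf_lt1.
  apply: le_limf_einf; exists r; split; first exact: num_real.
  move=> x rx; have x0 : 0 < x by lra.
  have nx0 : 0 < n * x by rewrite mulr_gt0 //; lra.
  rewrite lee_fin ler0_norm ?dpsi_le0 // ler_pdivrMr // mulrAC.
  rewrite ler_pdivlMr ?psi_gt0 //.
  have := decay x rx; have := tangent x (n * x) x0 nx0; lra.
- move=> [m0 [n [r [m01 n1 r0 decay]]]] m m1.
  have [k mk] := expr_unbounded _ _ m m01.
  have m00 : 0 < m0 by lra.
  exists (n ^+ k), r; split => // [|x rx].
    (* The exponent 0 would give [m <= 1], so the new dilation factor does exceed 1. *)
    case: k mk => [|k _]; first by rewrite expr0; lra.
    by rewrite exprn_egt1.
  apply: le_trans (iter_decay _ _ _ _ _ m00 (ltW n1) (ltW r0) decay k x rx) _.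
  have x0 : 0 < x by lra.
  rewrite ler_pM2l ?psi_gt0 //.
  by rewrite lef_pV2 ?posrE ?exprn_gt0 // (lt_trans ltr01 m1).
- move=> all_m; have lt12 : (1 : R) < 2 by lra.
  have [n [r [n1 r0 decay]]] := all_m 2 lt12.
  by exists 2, n, r.
Qed.
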